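(* Let $n\geq 4$ be an integer and let $C_n$ denote the cycle on $n$ vertices. If $n\notin\{5,7\}$, then $\sigma(C_n)=4$.
   Context: All graphs are finite, simple and undirected. A $k$-coloring of a graph $G$ is a function $c\colon V(G)\to\{1,\dots,k\}$. A walk in $G$ is a sequence $v_1\cdots v_r$ of vertices with $v_iv_{i+1}\in E(G)$ for all $i\in\{1,\dots,r-1\}$. A sequence $a_1\cdots a_{2t}$ is repetitive if $a_i=a_{i+t}$ for all $i\in\{1,\dots,t\}$. A walk $v_1\cdots v_{2t}$ is repetitive (with respect to $c$) if $c(v_1)\cdots c(v_{2t})$ is repetitive, and it is boring if $v_i=v_{i+t}$ for all $i\in\{1,\dots,t\}$. A coloring is walk-nonrepetitive if every repetitive walk is boring. The walk-nonrepetitive chromatic number $\sigma(G)$ is the minimum $k$ such that $G$ has a walk-nonrepetitive $k$-coloring. *)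

(* Defs.v *)
From mathcomp Require Import all_boot boolp.

Set Implicit Arguments.
Unset Strict Implicit.
Unset Printing Implicit Defensive.

Record sgraph := SGraph {
  vertex :> finType;
  adj : rel vertex;
  adj_sym : symmetric adj;
  adj_irrefl : irreflexive adj
}.

Section CycleGraph.
Variable n : nat.

(* [ordS] is the successor modulo n. The conjunct [i != j] matters only for
   n = 1, where it makes the relation irreflexive. This is the cycle C_n when
   n >= 3. *)
Definition cycle_adj : rel 'I_n :=
  [rel i j | (i != j) && ((j == ordS i) || (i == ordS j))].

Lemma cycle_adj_sym : symmetric cycle_adj.
Proof. by move=> i j; rewrite /cycle_adj /= eq_sym orbC. Qed.

Lemma cycle_adj_irrefl : irreflexive cycle_adj.
Proof. by move=> i; rewrite /cycle_adj /= eqxx. Qed.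

Definition cycle_graph : sgraph := SGraph cycle_adj_sym cycle_adj_irrefl.

End CycleGraph.

Definition walk (G : sgraph) (w : seq G) : bool := sorted (@adj G) w.

(* Indices start at 0, so a_1 ... a_(2t) is s with [onth s i] = Some a_(i+1). *)
Definition repetitive (T : Type) (s : seq T) : Prop :=
  exists t, size s = t.*2 /\ forall i, i < t -> onth s i = onth s (i + t).

Definition repetitive_walk (G : sgraph) (C : Type) (c : G -> C)
    (w : seq G) : Prop :=
  walk w /\ repetitive (map c w).

(* A walk is boring when its own vertex sequence satisfies v_i = v_(i+t). *)
Definition boring (G : sgraph) (w : seq G) : Prop := walk w /\ repetitive w.

Definition walk_nonrepetitive (G : sgraph) (C : Type) (c : G -> C) : Prop :=
  forall w : seq G, repetitive_walk c w -> boring w.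

(* 'I_k serves as the set of k colors. *)
Definition walk_nonrepetitive_colorable (G : sgraph) (k : nat) : Prop :=
  exists c : G -> 'I_k, walk_nonrepetitive c.

Lemma walk_nonrepetitive_colorable_card (G : sgraph) :
  walk_nonrepetitive_colorable G #|G|.
Proof.
exists enum_rank => w [walk_w [t [size_w rep_w]]]; split=> //.
exists t; split=> [|i lt_it]; first by rewrite size_map in size_w.
by apply: (inj_omap enum_rank_inj); rewrite -!onth_map; apply: rep_w.
Qed.

Lemma ex_walk_nonrepetitive_colorable (G : sgraph) :
  exists k, `[< walk_nonrepetitive_colorable G k >].
Proof. by exists #|G|; apply/asboolP/walk_nonrepetitive_colorable_card. Qed.

Definition sigma (G : sgraph) : nat :=
  ex_minn (ex_walk_nonrepetitive_colorable G).

(* Main.v *)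
(* Call a circular word over four letters good if it has no square and no
   factor aba.  Reading a good word of length n around C_n gives a
   walk-nonrepetitive coloring: lift a repetitive walk v_1 ... v_2t to the
   integers.  As no aba occurs, colors detect whether a walk turns back, so the
   second half of the lifted walk is a translate or a mirror image of the first
   half.  A translate by a nonzero amount modulo n yields a square; a mirror
   image meets the first half, and two walks with equal colors that meet once
   coincide.

   Good words exist for 4 <= n < 72, n <> 5, 7, by computation.  For n >= 72
   write n = 9 m + r with r < 9, so that r <= 8 <= m, take a good word of length m
   and replace each letter by a block of length 9 or 10 (r of them of length 10).

   Conversely three colors without aba or aa force the coloring abcabc..., in
   which the walk v_0 ... v_5 is repetitive. *)
Require Import Defs.
From mathcomp Require Import all_boot boolp zify.
From Stdlib Require Import Ascii String.

Set Implicit Arguments.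
Unset Strict Implicit.
Unset Printing Implicit Defensive.

(** * Good circular words and their test by computation *)

Definition square (w : nat -> nat) (i p : nat) : Prop :=
  forall j, j < p -> w (i + j) = w (i + j + p).

(** All periods below [n] are excluded, hence also squares longer than one turn, because a walk may
    wind around the cycle. *)
Record circular (n : nat) (w : nat -> nat) : Prop := Circular {
  circular_period : forall i, w (i + n) = w i;
  circular_lt4 : forall i, w i < 4;
  circular_nopal : forall i, w i <> w i.+2;
  circular_sqfree : forall i p, 0 < p < n -> ~ square w i p }.

Fixpoint digits (s : string) : seq nat :=
  if s is String a s' then (nat_of_ascii a - 48) :: digits s' else [::].

Fixpoint starts (p : nat) (u v : seq nat) : bool :=
  if p is p'.+1 then
    if u is a :: u' then
      if v is b :: v' then (a == b) && starts p' u' v' else false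
    else false
  else true.

(** Three copies of [s] contain every square that starts in the first copy and has period below
    [n]. *)
Definition circular_seq (s : seq nat) : bool :=
  let n := size s in
  let u := s ++ s ++ s in
  [&& all (fun a => a < 4) s,
      all (fun i => nth 0 u i != nth 0 u i.+2) (iota 0 n) &
      all (fun i => let v := drop i u in
        all (fun p => ~~ starts p v (drop p v)) (iota 1 n.-1)) (iota 0 n)].

(* The lexicographically least good circular words, found by backtracking. *)
Definition base_words : seq string := [::
  "0123"%string;
  "012013"%string;
  "01203123"%string;
  "012013023"%string;
  "0120130213"%string;
  "01201320123"%string;
  "012013021023"%string;
  "0120130231023"%string;
  "01201301203123"%string;
  "012013012031023"%string;
  "0120130120320123"%string;
  "01201301203120123"%string;
  "012013012031023123"%string;
  "0120130120310213023"%string;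
  "01201301203102103123"%string;
  "012013012031021031023"%string;
  "0120130120310210320123"%string;
  "01201301203102103120123"%string;
  "012013012031021031023123"%string;
  "0120130120310210312013023"%string;
  "01201301203102103120320123"%string;
  "012013012031021031023013023"%string;
  "0120130120310210310230213023"%string;
  "01201301203102103102301203123"%string;
  "012013012031021031023013021023"%string;
  "0120130120310210310230120320123"%string;
  "01201301203102103102301201320123"%string;
  "012013012031021031023012013021023"%string;
  "0120130120310210310230120130231023"%string;
  "01201301203102103102301201302103123"%string;
  "012013012031021031023012013021023123"%string;
  "0120130120310210310230120130120320123"%string;
  "01201301203102103102301201301203120123"%string;
  "012013012031021031023012013012031023123"%string;
  "0120130120310210310230120130120310213023"%string;
  "01201301203102103102301201301203103203123"%string;
  "012013012031021031023012013012031021320123"%string;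
  "0120130120310210310230120130120310210320123"%string;
  "01201301203102103102301201301203102103120123"%string;
  "012013012031021031023012013012031021032013023"%string;
  "0120130120310210310230120130120310210321023123"%string;
  "01201301203102103102301201301203102103120320123"%string;
  "012013012031021031023012013012031021031201320123"%string;
  "0120130120310210310230120130120310210312013023123"%string;
  "01201301203102103102301201301203102103120123023123"%string;
  "012013012031021031023012013012031021031201231023123"%string;
  "0120130120310210310230120130120310210312012301203123"%string;
  "01201301203102103102301201301203102103120123013023123"%string;
  "012013012031021031023012013012031021031201230120320123"%string;
  "0120130120310210310230120130120310210312012301302103123"%string;
  "01201301203102103102301201301203102103120123012013023123"%string;
  "012013012031021031023012013012031021031201230120132103123"%string;
  "0120130120310210310230120130120310210312012301201302103123"%string;
  "01201301203102103102301201301203102103120123012013021023123"%string;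
  "012013012031021031023012013012031021031201230120130123023123"%string;
  "0120130120310210310230120130120310210312012301201301231023123"%string;
  "01201301203102103102301201301203102103120123012013012031023123"%string;
  "012013012031021031023012013012031021031201230120130120310320123"%string;
  "0120130120310210310230120130120310210312012301201301203103203123"%string;
  "01201301203102103102301201301203102103120123012013012031021320123"%string;
  "012013012031021031023012013012031021031201230120130120310213023123"%string;
  "0120130120310210310230120130120310210312012301201301203102103203123"%string;
  "01201301203102103102301201301203102103120123012013012031021301203123"%string;
  "012013012031021031023012013012031021031201230120130120310210321023123"%string;
  "0120130120310210310230120130120310210312012301201301203102103120320123"%string;
  "01201301203102103102301201301203102103120123012013012031021031023103123"%string].

Lemma base_words_circular : all circular_seq (map digits base_words).
Proof. by vm_compute. Qed.


Lemma base_words_size n :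
  4 <= n < 72 -> n \notin [:: 5; 7] ->
  exists2 s, circular_seq s & size s = n.
Proof.
move=> n_range n_neq.
have: n \in map size (map digits base_words).
  have: n \in iota 4 68 by rewrite mem_iota; lia.
  have: all (fun k => (k \in [:: 5; 7]) || (k \in map size (map digits base_words)))
    (iota 4 68) by vm_compute.
  by move=> /allP/[apply]; rewrite (negbTE n_neq).
by case/mapP => s /(allP base_words_circular) s_circ ->; exists s.
Qed.

Lemma startsP p u v :
  p <= size u -> p <= size v ->
  (forall j, j < p -> nth 0 u j = nth 0 v j) -> starts p u v.
Proof.
elim: p u v => [//|p IHp] [|a u] [|b v] //= le_pu le_pv eq_uv.
have /= -> := eq_uv 0 isT; rewrite eqxx IHp // => j lt_jp.
exact: (eq_uv j.+1).
Qed.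

Definition repeat (s : seq nat) (i : nat) : nat := nth 0 s (i %% size s).

Lemma nth_cat3 (s : seq nat) i :
  i < 3 * size s -> nth 0 (s ++ s ++ s) i = repeat s i.
Proof.
move=> lt_i; rewrite /repeat !nth_cat.
case: ltnP => [lt1|ge1]; first by rewrite modn_small.
case: ltnP => [lt2|ge2]; first by rewrite -[in RHS](subnK ge1) modnDr modn_small.
by rewrite -[in RHS](subnK ge1) modnDr -[in RHS](subnK ge2) modnDr modn_small //; lia.
Qed.

Lemma circular_repeat s : 2 <= size s -> circular_seq s -> circular (size s) (repeat s).
Proof.
move=> s_ge2 /and3P[/allP lt4 /allP nopal /allP sqfree].
have lt_mod i : i %% size s < size s by rewrite ltn_mod; lia.
have shift i j : repeat s (i + j) = repeat s (i %% size s + j).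
  by rewrite /repeat modnDml.
split=> [i|i|i|i p p_range sq].
- by rewrite /repeat modnDr.
- exact/lt4/mem_nth.
- have := nopal (i %% size s); rewrite mem_iota lt_mod => /(_ isT)/eqP.
  have := lt_mod i.
  rewrite !nth_cat3; [|lia..]; rewrite -addn2 -shift addn2.
  by rewrite {1}/repeat modn_mod.
have := sqfree (i %% size s); rewrite mem_iota lt_mod => /(_ isT)/allP/(_ p).
rewrite mem_iota => /(_ ltac:(lia))/negP; apply; have := lt_mod i => lt_i.
apply: startsP => [||j lt_jp]; rewrite ?size_drop ?size_cat; try lia.
rewrite !nth_drop !nth_cat3; [|lia..].
by rewrite -shift sq // -addnA shift (addnC j) addnA.
Qed.

(** * The substitution blocks and their finite checks *)

(* All blocks begin with the marker 01, which occurs nowhere else in a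
   concatenation of blocks. *)
Definition blocks : seq (string * string) := [::
  ("012031023", "0120321023")%string; ("012302132", "0123021023")%string;
  ("013021032", "0130231023")%string; ("013213023", "0132102132")%string].

Definition block (e : bool) (a : nat) : seq nat :=
  let b := nth (EmptyString, EmptyString) blocks a in
  digits (if e then b.2 else b.1).

Lemma block_forall (Q : bool -> nat -> bool) :
  all (fun a => Q false a && Q true a) (iota 0 4) ->
  forall e a, a < 4 -> Q e a.
Proof.
move=> /allP Qall e a lt_a4; have := Qall a; rewrite mem_iota => /(_ lt_a4)/andP[].
by case: e.
Qed.

Lemma block_forall2 (Q : bool -> nat -> bool -> nat -> bool) :
  all (fun a => all (fun b =>
    [&& Q false a false b, Q false a true b, Q true a false b & Q true a true b])
    (iota 0 4)) (iota 0 4) ->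
  forall e a f b, a < 4 -> b < 4 -> Q e a f b.
Proof.
move=> /allP Qall e a f b lt_a4 lt_b4; have := Qall a.
rewrite mem_iota => /(_ lt_a4)/allP/(_ b).
by rewrite mem_iota => /(_ lt_b4)/and4P[]; case: e; case: f.
Qed.

Lemma size_block e a : a < 4 -> size (block e a) = 9 + e.
Proof.
by move=> lt_a4; apply/eqP; move: e a lt_a4; apply: block_forall; vm_compute.
Qed.

Lemma block_lt4 e a j : a < 4 -> nth 0 (block e a) j < 4.
Proof.
move=> lt_a4; have [lt_j|le_j] := ltnP j (size (block e a)).
  2: by rewrite nth_default.
have/allP/(_ _ (mem_nth 0 lt_j)) // : all (fun x => x < 4) (block e a).
by move=> {lt_j}; move: e a lt_a4; apply: block_forall; vm_compute.
Qed.

Lemma block_start0 e a : a < 4 -> nth 0 (block e a) 0 = 0.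
Proof.
by move=> lt_a4; apply/eqP; move: e a lt_a4; apply: block_forall; vm_compute.
Qed.

Lemma block_start1 e a : a < 4 -> nth 0 (block e a) 1 = 1.
Proof.
by move=> lt_a4; apply/eqP; move: e a lt_a4; apply: block_forall; vm_compute.
Qed.

(** Appending 01, the start of any next block, covers occurrences that straddle the border. *)
Lemma block_marker e a j :
  a < 4 -> j < size (block e a) ->
  nth 0 (block e a ++ [:: 0; 1]) j = 0 -> nth 0 (block e a ++ [:: 0; 1]) j.+1 = 1 ->
  j = 0.
Proof.
move=> lt_a4 lt_j nth0 nth1; apply/eqP.
have : all (fun j => (nth 0 (block e a ++ [:: 0; 1]) j == 0) &&
  (nth 0 (block e a ++ [:: 0; 1]) j.+1 == 1) ==> (j == 0)) (iota 0 (size (block e a))).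
  by move=> {j lt_j nth0 nth1}; move: e a lt_a4; apply: block_forall; vm_compute.
by move=> /allP/(_ j); rewrite mem_iota lt_j nth0 nth1 => /(_ isT).
Qed.

(** Three letters would not suffice: all blocks of 0 and 1 start with 012. *)
Lemma block_prefix e a f b :
  a < 4 -> b < 4 ->
  (forall j, j < 4 -> nth 0 (block e a) j = nth 0 (block f b) j) -> a = b.
Proof.
move=> lt_a4 lt_b4 eq_ab; apply/eqP.
have/implyP : starts 4 (block e a) (block f b) ==> (a == b).
  by move=> {eq_ab}; move: e a f b lt_a4 lt_b4; apply: block_forall2; vm_compute.
by apply; apply: startsP => //; rewrite size_block; lia.
Qed.

(** At least six letters of a block remain after a cut behind fewer than four. Five would not
    suffice: the long blocks of 0 and 1 both end in 21023. *)
Lemma block_suffix e a f b :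
  a < 4 -> b < 4 ->
  (forall j, j < 6 -> nth 0 (block e a) (size (block e a) - 6 + j) =
                      nth 0 (block f b) (size (block f b) - 6 + j)) -> a = b.
Proof.
move=> lt_a4 lt_b4 eq_ab; apply/eqP.
have/implyP : starts 6 (drop (size (block e a) - 6) (block e a))
                       (drop (size (block f b) - 6) (block f b)) ==> (a == b).
  by move=> {eq_ab}; move: e a f b lt_a4 lt_b4; apply: block_forall2; vm_compute.
apply; apply: startsP => [||j lt_j6]; last by rewrite !nth_drop eq_ab.
  by rewrite size_drop size_block //; lia.
by rewrite size_drop size_block //; lia.
Qed.

Definition good_seq (u : seq nat) : bool :=
  all (fun i => let v := drop i u in
    ((i.+2 < size u) ==> (nth 0 u i != nth 0 u i.+2)) &&
    all (fun p => (i + 2 * p <= size u) ==> ~~ starts p v (drop p v)) (iota 1 (size u)))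
  (iota 0 (size u)).

(** This excludes the squares too short to be lifted. The final 01 is the marker of a third block;
    [a != b] holds for neighbors in a square-free word. *)
Lemma block_pair_good e a f b :
  a < 4 -> b < 4 -> a != b -> good_seq (block e a ++ block f b ++ [:: 0; 1]).
Proof.
move=> lt_a4 lt_b4; apply/implyP.
by move: e a f b lt_a4 lt_b4; apply: block_forall2; vm_compute.
Qed.

(** * The infinite word obtained by substituting blocks *)

Section Substitution.
Variables (a : nat -> nat) (e : nat -> bool) (m : nat).
Hypothesis a_circ : circular m a.
Hypothesis m_gt1 : 1 < m.

(** [P k] is the position of block [k] in the infinite concatenation [T]; blocks being nonempty,
    [x.+1] of them reach beyond position [x]. *)
Let B k := block (e k) (a k).
Let P k := size (flatten (mkseq B k)).
Let T x := nth 0 (flatten (mkseq B x.+1)) x.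

Let a4 k : a k < 4 := circular_lt4 a_circ k.

Let P_succ k : P k.+1 = P k + (9 + e k).
Proof. by rewrite /P mkseqS flatten_rcons size_cat size_block. Qed.

Let P_leap k d : P k + 9 * d <= P (k + d) <= P k + 10 * d.
Proof.
elim: d => [|d IHd]; first by rewrite addn0; lia.
rewrite addnS P_succ; lia.
Qed.

Let P_mono k l : k <= l -> P k + 9 * (l - k) <= P l.
Proof. by move=> le_kl; have := P_leap k (l - k); rewrite subnKC //; lia. Qed.

Let P_ge k : 9 * k <= P k.
Proof. by have := P_leap 0 k; rewrite add0n /P /=; lia. Qed.

Let nth_flatten_block k j N :
  j < size (B k) -> k < N -> nth 0 (flatten (mkseq B N)) (P k + j) = nth 0 (B k) j.
Proof.
move=> lt_j; elim: N => [//|N IHN]; rewrite ltnS => le_kN.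
rewrite mkseqS flatten_rcons nth_cat -/(P N).
have [lt_kN|ge_kN] := ltnP k N.
  rewrite ifT ?IHN //; have := P_mono lt_kN; rewrite P_succ.
  by move: lt_j; rewrite size_block //; lia.
have -> : N = k by lia.
by rewrite ltnNge leq_addr /= addKn.
Qed.

Let T_block k j : j < size (B k) -> T (P k + j) = nth 0 (B k) j.
Proof. by move=> lt_j; apply: nth_flatten_block => //; have := P_ge k; lia. Qed.

Let locate x : exists k j, j < size (B k) /\ x = P k + j.
Proof.
elim: x => [|x [k [j [lt_j ->]]]]; first by exists 0, 0; rewrite size_block.
have [lt_j1|ge_j1] := ltnP j.+1 (size (B k)); first by exists k, j.+1; rewrite addnS.
exists k.+1, 0; split; first by rewrite size_block.
by move: lt_j ge_j1; rewrite P_succ size_block //; lia.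
Qed.

Let T_start0 k : T (P k) = 0.
Proof. by rewrite -[P k]addn0 T_block ?block_start0 ?size_block. Qed.

Let T_start1 k : T (P k).+1 = 1.
Proof. by rewrite -addn1 T_block ?block_start1 ?size_block. Qed.

Let T_marker x : T x = 0 -> T x.+1 = 1 -> exists k, x = P k.
Proof.
have [k [j [lt_j ->]]] := locate x => T0 T1; exists k.
suff -> : j = 0 by rewrite addn0.
apply: (@block_marker (e k) (a k)); rewrite -/(B k) ?nth_cat //.
  by rewrite lt_j -T_block.
case: ltnP => [lt_j1|ge_j1]; first by rewrite -T_block // addnS.
move: lt_j ge_j1 T1; rewrite size_block // => lt_j ge_j1.
(* Here the letter 1 would be the first letter of the next block, which is 0. *)
have -> : (P k + j).+1 = P k.+1 by rewrite P_succ; lia.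
by rewrite T_start0.
Qed.

Let T_pair k j : P k + j < P k.+2 + 2 ->
  T (P k + j) = nth 0 (B k ++ B k.+1 ++ [:: 0; 1]) j.
Proof.
move=> lt_j; rewrite !nth_cat; case: ltnP => [|ge1]; first exact: T_block.
have Bk l : size (B l) = 9 + e l by rewrite size_block.
case: ltnP => [lt2|ge2].
  by rewrite -T_block //; congr T; move: ge1; rewrite P_succ Bk; lia.
have E : P k + j = P k.+2 + (j - size (B k) - size (B k.+1)).
  by move: ge1 ge2; rewrite !P_succ !Bk; lia.
rewrite E in lt_j *; move: (j - _ - _) lt_j => [|[|?]] lt_j; last lia.
- by rewrite addn0 T_start0.
- by rewrite addn1 T_start1.
Qed.

Let a_neq k : a k != a k.+1.
Proof.
apply/eqP => eq_a; apply: (circular_sqfree a_circ (i := k) (p := 1)) => // j.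
by rewrite ltnS leqn0 => /eqP ->; rewrite addn0 addn1.
Qed.

Let T_nopal x : T x <> T x.+2.
Proof.
have [k [j [lt_j ->]]] := locate x.
have Bk l : size (B l) = 9 + e l by rewrite size_block.
have sz : size (B k ++ B k.+1 ++ [:: 0; 1]) = 20 + e k + e k.+1.
  by rewrite !size_cat !Bk /=; lia.
rewrite -!addnS !T_pair; try by move: lt_j; rewrite !P_succ Bk; lia.
have/allP := block_pair_good (e k) (e k.+1) (a4 k) (a4 k.+1) (a_neq k).
move=> /(_ j); rewrite -/(B k) -/(B k.+1) sz mem_iota.
move=> /(_ ltac:(move: lt_j; rewrite Bk; lia)).
by case/andP => /implyP/(_ ltac:(move: lt_j; rewrite Bk; lia))/eqP.
Qed.

Let T_short_sqfree k i p :
  0 < p -> P k <= i < P k.+1 -> i + 2 * p <= P k.+2 + 2 -> ~ square T i p.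
Proof.
move=> p_gt0 i_range le_end sq.
have Bk l : size (B l) = 9 + e l by rewrite size_block.
have sz : size (B k ++ B k.+1 ++ [:: 0; 1]) = 20 + e k + e k.+1.
  by rewrite !size_cat !Bk /=; lia.
move: i_range le_end; rewrite !P_succ => i_range le_end.
have/allP := block_pair_good (e k) (e k.+1) (a4 k) (a4 k.+1) (a_neq k).
move=> /(_ (i - P k)); rewrite -/(B k) -/(B k.+1) sz mem_iota => /(_ ltac:(lia)).
case/andP => _ /allP/(_ p); rewrite mem_iota.
move=> /(_ ltac:(lia))/implyP/(_ ltac:(lia))/negP.
apply; apply: startsP => [||j lt_jp]; rewrite ?size_drop ?sz; try lia.
rewrite !nth_drop -!T_pair ?P_succ; try lia.
have -> : P k + (i - P k + j) = i + j by lia.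
have -> : P k + (i - P k + (p + j)) = i + j + p by lia.
exact: sq.
Qed.

(** * Lifting squares back through the substitution *)

Section Square.
Variables (k i p : nat).
(** [P k.+1] is thus the first block start at or after [i]. *)
Hypotheses (p_gt0 : 0 < p) (lt_ki : P k < i) (le_ik : i <= P k.+1).
Hypothesis sq : square T i p.

Let sq_at x : i <= x < i + p -> T x = T (x + p).
Proof. by move=> x_range; rewrite -(subnKC (n := x) (m := i)) ?sq; lia. Qed.

(** The marker identifies block starts, and the square copies it when both its letters lie in the
    first half. *)
Let shift_start x : i <= x -> x + 2 <= i + p -> 
  (exists l, x = P l) <-> exists l, x + p = P l.
Proof.
move=> le_ix le_x2.
have T0 : T x = T (x + p) by apply: sq_at; lia.
have T1 : T x.+1 = T (x + p).+1 by rewrite sq_at ?addSn //; lia.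
split=> -[l El]; apply: T_marker.
- by rewrite -T0 El T_start0.
- by rewrite -T1 El T_start1.
- by rewrite T0 El T_start0.
- by rewrite T1 El T_start1.
Qed.

(* Otherwise the square contains at most one whole marker, so it fits into two
   blocks and a marker. *)
Lemma square_long : P k.+1 + 2 <= i + p.
Proof.
rewrite leqNgt; apply/negP => lt_short.
have Pk2 := P_succ k.+1; have Pk3 := P_succ k.+2.
have [le_end|gt_end] := leqP (i + 2 * p) (P k.+2 + 1).
  have [lt_ik|ge_ik] := ltnP i (P k.+1).
    by apply: (T_short_sqfree (k := k) (i := i) (p := p)) => //; lia.
  by apply: (T_short_sqfree (k := k.+1) (i := i) (p := p)) => //; lia.
(* The marker at [P k.+2] lies in the second half; its copy in the first half would start a block
   strictly between [P k] and [P k.+1]. *)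
have [l El] : exists l, P k.+2 - p = P l.
  by apply/shift_start; [lia..|]; exists k.+2; lia.
have [le_lk|lt_kl] := leqP l k; first by have := P_mono le_lk; lia.
by have := P_mono lt_kl; lia.
Qed.

(* The period maps block starts to block starts, so it identifies consecutive
   blocks except possibly at the ends.  The block k + q straddling the centre i + p
   has either four initial letters before i + p, which are repeated by the block
   at the end of the square, or six final letters after it, which repeat those of
   the block k at its beginning. *)
Lemma square_lift : exists q, [/\ 0 < q, P (k.+1 + q) = P k.+1 + p &
  square a k q \/ square a k.+1 q].
Proof.
have long := square_long.
have [l El] : exists l, P k.+1 + p = P l.
  by apply: (shift_start (x := P k.+1) _ _).1; [lia..|exists k.+1].
have lt_kl : k.+1 < l.
  by rewrite ltnNge; apply/negP => le_lk; have := P_mono le_lk; lia.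
have [q [q_gt0 Eq]] : exists q, 0 < q /\ l = k.+1 + q by exists (l - k.+1); lia.
subst l; exists q; split=> //.
have sync d : P (k.+1 + d) + 2 <= i + p -> P (k.+1 + d) + p = P (k.+1 + d + q).
  elim: d => [|d IHd]; first by rewrite addn0 El.
  rewrite !addnS => le_d; have := P_succ (k.+1 + d) => Pd.
  have Ed := IHd ltac:(lia).
  have [s Es] : exists s, P (k.+1 + d).+1 + p = P s.
    apply: (shift_start (x := P (k.+1 + d).+1) _ _).1; [|lia|by exists (k.+1 + d).+1].
    by have := P_leap k.+1 d; lia.
  rewrite Es; congr P.
  (* [P s] exceeds [P (k.+1 + d + q)] by 9 or 10, and two blocks already take 18 letters. *)
  have [le_s|lt_s] := leqP s (k.+1 + d + q); first by have := P_mono le_s; lia.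
  by have := P_mono lt_s; rewrite P_succ; lia.
have letter d : P (k.+1 + d) + 4 <= i + p -> a (k.+1 + d) = a (k.+1 + d + q).
  move=> le_d; apply: (@block_prefix (e (k.+1 + d)) _ (e (k.+1 + d + q))) => // j lt_j4.
  rewrite -!T_block ?size_block //; try lia.
  rewrite -sync; last lia.
  by rewrite sq_at; [congr T; lia|have := P_leap k.+1 d; lia].
have inner d : d.+1 < q -> a (k.+1 + d) = a (k.+1 + d + q).
  move=> lt_dq; apply: letter; have := P_succ k.
  by have := @P_mono (k.+1 + d) (k.+1 + q) ltac:(lia); lia.
have [q' Eq'] : exists q', q = q'.+1 by exists q.-1; lia.
have [le_y|gt_y] := leqP (P (k.+1 + q') + 4) (i + p).
  right=> d; rewrite {1}Eq' ltnS leq_eqVlt => /orP[/eqP ->|lt_d]; first exact: letter.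
  by apply: inner; lia.
left=> -[|d] lt_d; last by rewrite addnS -addSn inner.
rewrite addn0.
have Py := P_succ (k.+1 + q'); rewrite -addnS -Eq' -El in Py.
have Pk := P_succ k.
have Ekq : k + q = k.+1 + q' by lia.
apply: (@block_suffix (e k) _ (e (k + q))) => // j lt_j6.
rewrite -!T_block ?size_block //; try lia.
rewrite sq_at; last lia.
by congr T; rewrite Ekq; lia.
Qed.

End Square.

(** Since [m] blocks fill exactly one period [n], a square of period below [n] lifts to a square of
    period below [m] in [a]. *)
Lemma circular_substitution n :
  (forall k, e (k + m) = e k) -> P m = n -> circular n T.
Proof.
move=> e_per Pm.
have B_per k : B (k + m) = B k by rewrite /B e_per (circular_period a_circ).
have P_per k : P (k + m) = P k + n.
  elim: k => [|k IHk]; first by rewrite add0n Pm.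
  by rewrite addSn !P_succ e_per IHk; lia.
have T_per x : T (x + n) = T x.
  have [k [j [lt_j ->]]] := locate x.
  have -> : P k + j + n = P (k + m) + j by rewrite P_per; lia.
  by rewrite !T_block ?B_per.
split=> // [x|i p p_range sq].
  by have [k [j [lt_j ->]]] := locate x; rewrite T_block // block_lt4.
(* Moving the square by one period ensures that some letter precedes it. *)
have sq' : square T (i + n) p.
  move=> j lt_jp; have := sq j lt_jp.
  by rewrite -(T_per (i + j)) -(T_per (i + j + p)); congr (T _ = T _); lia.
have [k [j [lt_j Ek]]] := locate (i + n).-1.
rewrite size_block // in lt_j.
have [|||q [q_gt0 Pq sq_a]] := square_lift (k := k) _ _ _ sq'; rewrite ?P_succ; try lia.
have lt_qm : q < m.
  rewrite ltnNge; apply/negP => le_mq.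
  by have := @P_mono (k.+1 + m) (k.+1 + q) ltac:(lia); rewrite P_per; lia.
by case: sq_a; apply: (circular_sqfree a_circ); rewrite q_gt0.
Qed.

(* Existence of good circular words *)
End Substitution.

Lemma circular_exists n :
  4 <= n -> n \notin [:: 5; 7] -> exists w, circular n w.
Proof.
elim/ltn_ind: n => n IHn n_ge4 n_neq.
have [n_lt72|n_ge72] := ltnP n 72.
  have [||s s_circ size_s] := @base_words_size n; rewrite ?n_ge4 //.
  by rewrite -size_s; exists (repeat s); apply: circular_repeat => //; lia.
(* The bound [8 <= m] also keeps the induction clear of lengths 5 and 7. *)
have [m [r [En m_ge8 r_lt9]]] : exists m r, [/\ n = 9 * m + r, 8 <= m & r < 9].
  by exists (n %/ 9), (n %% 9); split; lia.
have [|||a a_circ] := IHn m; rewrite ?inE; try lia.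
(* The long blocks are the first [r] of each run of [m]. *)
pose e k := k %% m < r.
have sizeP k : k <= m ->
    size (flatten (mkseq (fun k => block (e k) (a k)) k)) = 9 * k + minn k r.
  elim: k => [|k IHk] lt_km; first by rewrite min0n.
  rewrite mkseqS flatten_rcons size_cat IHk; last lia.
  rewrite size_block ?(circular_lt4 a_circ) // /e modn_small //.
  by case: ltnP; lia.
eexists; apply: (circular_substitution a_circ (e := e)); first lia.
  by move=> k; rewrite /e modnDr.
by rewrite sizeP //; lia.
Qed.

(** * Repetitive walks lifted to the integers *)

Lemma onth_nth_some (T : Type) (x0 : T) (s : seq T) i :
  i < size s -> onth s i = Some (nth x0 s i).
Proof. by elim: s i => [|x s IHs] [|i] //= lt_is; rewrite IHs. Qed.

Lemma repetitive_nth (T : Type) (x0 : T) (s : seq T) t :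
  size s = t.*2 ->
  (forall i, i < t -> nth x0 s i = nth x0 s (i + t)) <->
  (forall i, i < t -> onth s i = onth s (i + t)).
Proof.
move=> sz; split=> eq_s i lt_it; have := eq_s i lt_it.
  by rewrite !(onth_nth_some x0); [move=> -> | lia..].
by rewrite !(onth_nth_some x0); [case | lia..].
Qed.

Lemma circular_mod n w : circular n w -> forall i, w (i %% n) = w i.
Proof.
move=> w_circ i; rewrite {2}(divn_eq i n) addnC.
elim: (i %/ n) => [|k IHk]; first by rewrite addn0.
by rewrite mulSn addnCA addnC (circular_period w_circ).
Qed.

Section LiftedWalk.
Variables (n : nat) (w : nat -> nat) (x : nat -> nat) (t : nat).
Hypothesis w_circ : circular n w.
Hypothesis n_gt1 : 1 < n.
Hypothesis x_step : forall i, i.+1 < t.*2 -> x i.+1 = (x i).+1 \/ x i = (x i.+1).+1.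
Hypothesis x_rep : forall i, i < t -> w (x i) = w (x (i + t)).

Let w_neq1 y : w y <> w y.+1.
Proof.
move=> eq_w; apply: (circular_sqfree w_circ (i := y) (p := 1)) => // j.
by rewrite ltnS leqn0 => /eqP ->; rewrite addn0 addn1.
Qed.

Let w_neq2 y : w y <> w y.+2 := @circular_nopal _ _ w_circ y.

(** Three consecutive letters are distinct, so a color determines a position up to distance two. *)
Let w_near y z : w y = w z -> y <= z.+2 -> z <= y.+2 -> y = z.
Proof.
move=> eq_w le_yz le_zy.
have : y = z \/ y = z.+1 \/ z = y.+1 \/ y = z.+2 \/ z = y.+2 by lia.
case=> [//|[|[|[|]]]] E; rewrite E in eq_w.
- by case: (w_neq1 (esym eq_w)).
- by case: (w_neq1 eq_w).
- by case: (w_neq2 (esym eq_w)).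
- by case: (w_neq2 eq_w).
Qed.

(* Steps i and i + t of the walk either always agree or always disagree, since
   the colors detect whether a walk turns back. *)
Lemma lifted_walk_dichotomy :
  (forall i, i < t -> x (i + t) + x 0 = x i + x t) \/
  (forall i, i < t -> x (i + t) + x i = x 0 + x t).
Proof.
suff step s : s <= t ->
    (forall i, i < s -> x (i + t) + x 0 = x i + x t) \/
    (forall i, i < s -> x (i + t) + x i = x 0 + x t) by exact: step.
elim: s => [|s IHs] lt_st; first by left.
have extend (Q : nat -> Prop) :
    (forall i, i < s -> Q i) -> Q s -> forall i, i < s.+1 -> Q i.
  by move=> Qlt Qs i; rewrite ltnS leq_eqVlt => /orP[/eqP ->|/Qlt].
case: s => [|[|s]] in lt_st IHs extend *.
- by left; apply: extend => //; rewrite add0n addnC.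
(* The first step of each half decides between translate and mirror image. *)
- have := x_step (i := 0) ltac:(lia); have := x_step (i := t) ltac:(lia).
  rewrite -[t.+1]/(1 + t) => step_t step_0.
  have [same|opp] : x (1 + t) + x 0 = x 1 + x t \/ x (1 + t) + x 1 = x 0 + x t by lia.
    by left; apply: extend => // -[|//] _; rewrite add0n addnC.
  by right; apply: extend => // -[|//] _; rewrite add0n addnC.
have s0 := x_step (i := s) ltac:(lia); have s1 := x_step (i := s.+1) ltac:(lia).
have t0 := x_step (i := s + t) ltac:(lia); have t1 := x_step (i := s.+1 + t) ltac:(lia).
rewrite -!addSn in t0 t1.
have turn : x s = x s.+2 <-> x (s + t) = x (s.+2 + t).
  have eq0 := x_rep (i := s) ltac:(lia); have eq2 := x_rep (i := s.+2) ltac:(lia).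
  by split=> E; apply: w_near; try lia; congruence.
by case: (IHs ltac:(lia)) => IH; [left|right]; apply: extend => //;
   have := IH s ltac:(lia); have := IH s.+1 ltac:(lia); lia.
Qed.

(** A discrete intermediate value property, as each step moves by one. *)
Let hit a s y : a + s < t.*2 ->
  minn (x a) (x (a + s)) <= y <= maxn (x a) (x (a + s)) ->
  exists2 i, i <= s & x (a + i) = y.
Proof.
elim: s => [|s IHs] lt_s y_range;
  first by exists 0 => //; rewrite addn0 in y_range *; lia.
have := x_step (i := a + s) ltac:(lia); rewrite -addnS => st.
have [->|neq] := eqVneq y (x (a + s.+1)); first by exists s.+1.
have [|i le_i Ei] := IHs ltac:(lia); first lia.
by exists i => //; lia.
Qed.

(** One step after or before a meeting, the halves are at distance 0 or 2, and equal colors rule out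
    2. *)
Let meet_all i : i < t -> x i = x (i + t) -> forall j, j < t -> x j = x (j + t).
Proof.
move=> lt_it Ei.
have fwd d : i + d < t -> x (i + d) = x (i + d + t).
  elim: d => [|d IHd] lt_d; first by rewrite addn0.
  have E := IHd ltac:(lia); rewrite !addnS addSn.
  have a1 := x_step (i := i + d) ltac:(lia).
  have a2 := x_step (i := i + d + t) ltac:(lia).
  by apply: w_near; [rewrite x_rep ?addSn //; lia|lia..].
have bwd d : d <= i -> x (i - d) = x (i - d + t).
  elim: d => [|d IHd] le_d; first by rewrite subn0.
  have E := IHd ltac:(lia).
  have [j Ej] : exists j, i - d = j.+1 by exists (i - d.+1); lia.
  have -> : i - d.+1 = j by lia.
  rewrite Ej addSn in E.
  have a1 := x_step (i := j) ltac:(lia); have a2 := x_step (i := j + t) ltac:(lia).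
  by apply: w_near; [rewrite x_rep //; lia|lia..].
move=> j lt_jt; have [le_ji|lt_ij] := leqP j i.
  by rewrite -(subKn le_ji) bwd //; lia.
by rewrite -(subnKC (ltnW lt_ij)) fwd //; lia.
Qed.

(** The shift [d] may exceed [n], but by periodicity its residue is also a period, and a positive
    residue would give a forbidden square. *)
Let no_shift d y : 0 < d -> (forall z, y <= z < y + d -> w z = w (z + d)) -> d %% n = 0.
Proof.
move=> d_gt0 sq; apply/eqP; rewrite -leqn0 leqNgt; apply/negP => r_gt0.
apply: (circular_sqfree w_circ (i := y) (p := d %% n)) => [|j lt_j].
  by rewrite r_gt0 ltn_mod; lia.
rewrite sq; last by have := leq_mod d n; lia.
by rewrite -(circular_mod w_circ) -modnDmr (circular_mod w_circ).
Qed.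

Lemma lifted_walk_boring i : i < t -> x i = x (i + t) %[mod n].
Proof.
move=> lt_it; have t_gt0 : 0 < t by lia.
(* As [x t.-1] and [x t] are adjacent, the first half alone visits all positions from [x 0] to just
   before [x t]. *)
have last_step := x_step (i := t.-1) ltac:(lia); rewrite prednK // in last_step.
have mod_shift y z d : d %% n = 0 -> z = y + d -> y = z %[mod n].
  by move=> d0 ->; rewrite -modnDmr d0 addn0.
case: lifted_walk_dichotomy => [same|opp].
  have same_i := same i lt_it; have same_last := same t.-1 ltac:(lia).
  have [lt_t0|lt_0t|E] := ltngtP (x t) (x 0); last by congr (_ %% _); lia.
    suff d0 : (x 0 - x t) %% n = 0 by apply/esym/(mod_shift _ _ _ d0); lia.
    (* The walk drifts downwards, so the square starts at its final position and its first half is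
       visited by the second half of the walk. *)
    apply: (no_shift (y := x (t.-1 + t))); first lia.
    move=> z z_range; have [||j le_j <-] := @hit t t.-1 z; rewrite ?(addnC t); try lia.
    have same_j := same j ltac:(lia); rewrite -x_rep; last lia.
    by congr w; lia.
  suff d0 : (x t - x 0) %% n = 0 by apply: (mod_shift _ _ _ d0); lia.
  apply: (no_shift (y := x 0)); first lia.
  move=> z z_range; have [||j le_j <-] := @hit 0 t.-1 z; rewrite ?add0n; try lia.
  have same_j := same j ltac:(lia); rewrite x_rep; last lia.
  by congr w; lia.
(* The second half mirrors the first one, and the walk crosses the centre of
   the reflection. *)
suff [j lt_jt Ej] : exists2 j, j < t & x j = x (j + t).
  by rewrite (meet_all lt_jt Ej lt_it).
(* A position within 1/2 of the centre is at distance at most one from its mirror image. *)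
have meet j : j < t -> 2 * x j <= (x 0 + x t).+1 -> x 0 + x t <= (2 * x j).+1 ->
    exists2 j, j < t & x j = x (j + t).
  move=> lt_jt le1 le2; exists j => //; have opp_j := opp j lt_jt.
  by apply: w_near; [exact: x_rep|lia..].
have [lt_t0|lt_0t|E] := ltngtP (x t) (x 0); last by exists 0.
  (* Both cases round towards [x 0], since the first half may stop one short of [x t]. *)
  have [||j le_j Ej] := @hit 0 t.-1 ((x 0 + x t).+1 %/ 2); rewrite ?add0n; try lia.
  by rewrite add0n in Ej; apply: (meet j); lia.
have [||j le_j Ej] := @hit 0 t.-1 ((x 0 + x t) %/ 2); rewrite ?add0n; try lia.
by rewrite add0n in Ej; apply: (meet j); lia.
Qed.

End LiftedWalk.

(** * Walks on the cycle and the upper bound *)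

Lemma cycle_walk_lift n (v0 : 'I_n) (s : seq 'I_n) :
  sorted (@cycle_adj n) s ->
  exists x : nat -> nat,
    (forall i, i < size s -> x i %% n = nth v0 s i) /\
    (forall i, i.+1 < size s -> x i.+1 = (x i).+1 \/ x i = (x i.+1).+1).
Proof.
case: s => [|v s] /=; first by exists id.
suff lift y : path (@cycle_adj n) v s -> y %% n = v -> size s <= y ->
    exists x, [/\ x 0 = y, forall i, i <= size s -> x i %% n = nth v0 (v :: s) i &
      forall i, i < size s -> x i.+1 = (x i).+1 \/ x i = (x i.+1).+1].
  (* Starting at least [size s] above zero leaves room for every step to go down. *)
  move=> path_s; have [||x [_ x_mod x_step]] := lift (v + size s * n) path_s.
  - by rewrite addnC modnMDl modn_small.
  - by have := ltn_ord v; nia.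
  by exists x.
elim: s v y => [|u s IHs] v y /=.
  by move=> _ y_mod _; exists (fun=> y); split=> // -[].
case/andP=> /andP[_ adj_vu] path_s y_mod le_y.
have [z [z_mod le_z step_yz]] :
    exists z, [/\ z %% n = u, size s <= z & z = y.+1 \/ y = z.+1].
  case/orP: adj_vu => /eqP E.
    exists y.+1; split; [|lia|by left].
    by rewrite E /= -y_mod -addn1 -modnDml addn1.
  exists y.-1; split; [|lia|right; lia].
  rewrite -(modn_small (ltn_ord u)); apply/eqP; rewrite -(eqn_modDr 1).
  by rewrite !addn1 prednK ?y_mod ?E //=; lia.
have [x [x0 x_mod x_step]] := IHs u z path_s z_mod le_z.
exists (fun i => if i is j.+1 then x j else y); split=> // -[|i] //.
- exact: x_mod.
- by rewrite x0.
- exact: x_step.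
Qed.

Lemma circular_colorable n w :
  1 < n -> circular n w -> walk_nonrepetitive_colorable (cycle_graph n) 4.
Proof.
move=> n_gt1 w_circ; pose v0 : cycle_graph n := Ordinal (ltnW n_gt1).
pose c (v : cycle_graph n) : 'I_4 := inord (w v).
have cK v : c v = w v :> nat by rewrite inordK ?(circular_lt4 w_circ).
exists c => s [walk_s [t [size_s rep_s]]]; split=> //.
have size_st : size s = t.*2 by rewrite size_map in size_s.
have := cycle_walk_lift v0 walk_s; rewrite size_st => -[x [x_mod x_step]].
exists t; split=> //; apply/(repetitive_nth v0 size_st) => i lt_it.
have rep_c := (repetitive_nth (c v0) size_s).2 rep_s.
apply: val_inj; rewrite /= -!x_mod; [|lia..].
apply: (lifted_walk_boring w_circ n_gt1 (t := t)) => // j lt_jt.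
have w_x l : l < t.*2 -> w (x l) = c (nth v0 s l).
  by move=> lt_l; rewrite cK -x_mod // (circular_mod w_circ).
rewrite !w_x; [|lia..]; have := rep_c j lt_jt.
by rewrite !(nth_map v0) ?size_st => [->||] //; lia.
Qed.

(** * The lower bound *)

Lemma cycle_colors_ge4 n k :
  4 <= n -> walk_nonrepetitive_colorable (cycle_graph n) k -> 4 <= k.
Proof.
move=> n_ge4 [c c_nonrep]; rewrite leqNgt; apply/negP => k_lt4.
have n_gt0 : 0 < n by lia.
pose v i : cycle_graph n := Ordinal (ltn_pmod i n_gt0).
have adj_succ i : adj (v i) (v i.+1).
  rewrite /= /cycle_adj /= -!val_eqE /= -addn1 -(modnDml i) addn1 eqxx andbT.
  have := ltn_pmod i n_gt0; move: (i %% n) => j lt_jn.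
  have [lt_j1|ge_j1] := ltnP j.+1 n; first by rewrite modn_small //; lia.
  have -> : j.+1 = n by lia.
  by rewrite modnn; lia.
have adj_pred i : adj (v i.+1) (v i) by rewrite adj_sym.
have walk_cons u u' (r : seq (cycle_graph n)) :
  walk [:: u, u' & r] = adj u u' && walk (u' :: r) by [].
have v_inj i d : 0 < d < 4 -> v i <> v (i + d).
  move=> d_range /(congr1 val) /= /eqP.
  by rewrite -{1}[i]addn0 eqn_modDl mod0n modn_small; lia.
have boring_nth s t i : size s = t.*2 -> i < t -> boring s ->
    nth (v 0) s i = nth (v 0) s (i + t).
  move=> size_s lt_it [_ [t' [size_s' rep_s]]].
  have Et : t' = t by apply: double_inj; rewrite -size_s.
  by subst t'; apply: (repetitive_nth _ size_s).2 rep_s _ lt_it.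
have neq1 i : c (v i) <> c (v i.+1).
  move=> eq_c; apply: (v_inj i 1) => //; rewrite addn1.
  apply: (boring_nth [:: v i; v i.+1] 1 0) => //; apply: c_nonrep.
  by split; [rewrite !walk_cons adj_succ|exists 1; split=> // -[|//] _ /=; rewrite eq_c].
have neq2 i : c (v i) <> c (v i.+2).
  move=> eq_c; apply: (v_inj i 2) => //; rewrite addn2.
  (* An aba makes this walk, which turns back at [v i.+2], repetitive. *)
  apply: (boring_nth [:: v i; v i.+1; v i.+2; v i.+1] 2 0) => //; apply: c_nonrep.
  split; first by rewrite !walk_cons !adj_succ adj_pred.
  by exists 2; split=> // -[|[|//]] _ /=; rewrite ?eq_c.
(* With at most three colors, [v i.+3] must avoid the two distinct colors before it, and so must
   [v i]. *)
have per3 i : c (v i) = c (v i.+3).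
  apply: val_inj => /=.
  have neq (a b : 'I_k) : a <> b -> a <> b :> nat by move=> ab /val_inj.
  move: (neq _ _ (neq1 i)) (neq _ _ (neq2 i)) (neq _ _ (neq1 i.+1))
    (neq _ _ (neq2 i.+1)) (neq _ _ (neq1 i.+2)).
  move: (ltn_ord (c (v i))) (ltn_ord (c (v i.+1))).
  move: (ltn_ord (c (v i.+2))) (ltn_ord (c (v i.+3))).
  lia.
(* For [n] equal to 4 or 5 the walk below closes up and revisits vertices, but still [v 0] differs
   from [v 3]. *)
apply: (v_inj 0 3) => //.
apply: (boring_nth [:: v 0; v 1; v 2; v 3; v 4; v 5] 3 0) => //; apply: c_nonrep.
split; first by rewrite !walk_cons !adj_succ.
by exists 3; split=> // -[|[|[|//]]] _ /=; rewrite -?per3.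
Qed.

Theorem theorem1 (n : nat) (n_ge4 : 4 <= n) (n_neq57 : n \notin [:: 5; 7]) :
  sigma (cycle_graph n) = 4.
Proof.
rewrite /sigma; case: ex_minnP => k /asboolP k_col k_min.
have [w w_circ] := circular_exists n_ge4 n_neq57.
have four_col := circular_colorable (ltac:(lia) : 1 < n) w_circ.
have k_le4 : k <= 4 by apply/k_min/asboolP.
by apply/eqP; rewrite eqn_leq k_le4 (cycle_colors_ge4 n_ge4 k_col).
Qed.
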